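(* Let $T$ be a self-adjoint operator in a complex Hilbert space $\mathcal H$ and let $A$ be a $T$-bounded linear operator in $\mathcal H$ with $T$-bound $<1$. Let $a,b\ge0$, $b<1$, be such that $$\|Ax\|^2\le a^2\|x\|^2+b^2\|Tx\|^2,\qquad x\in\mathcal D(T).$$ (i) For every $z\in\mathbb C$ with $|\operatorname{Im} z|^2>\frac{a^2+b^2|\operatorname{Re} z|^2}{1-b^2}$, $$\|(T+A-z)^{-1}\|\le\frac1{|\operatorname{Im} z|-\sqrt{a^2+b^2|z|^2}} .$$ (ii) Suppose $T$ has a spectral gap $(\alpha_T,\beta_T)\subset\mathbb R$, i.e. $\sigma(T)\cap(\alpha_T,\beta_T)=\emptyset$ with $\alpha_T,\beta_T\in\sigma(T)$, such that $\sqrt{a^2+b^2\alpha_T^2}+\sqrt{a^2+b^2\beta_T^2}<\beta_T-\alpha_T$, and set $\alpha_{T+A}:=\alpha_T+\sqrt{a^2+b^2\alpha_T^2}$, $\beta_{T+A}:=\beta_T-\sqrt{a^2+b^2\beta_T^2}$. For every $z\in\mathbb C$ with $\alpha_{T+A}<\operatorname{Re} z<\beta_{T+A}$, $$\|(T+A-z)^{-1}\|\le\frac1{\sqrt{\min\{\operatorname{Re} z-\alpha_T,\ \beta_T-\operatorname{Re} z\}^2+(\operatorname{Im} z)^2}}\cdot\frac1{1-\max\Big\{b,\ \frac{\sqrt{a^2+b^2\alpha_T^2}}{\operatorname{Re} z-\alpha_T},\ \frac{\sqrt{a^2+b^2\beta_T^2}}{\beta_T-\operatorname{Re} z}\Big\}}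 .$$
   Context: $\mathcal D(\cdot)$ denotes the domain. A linear operator $A$ (not necessarily symmetric, closed or bounded) is $T$-bounded if $\mathcal D(T)\subset\mathcal D(A)$ and there are $a,b\ge0$ with $\|Ax\|^2\le a^2\|x\|^2+b^2\|Tx\|^2$ for all $x\in\mathcal D(T)$; the infimum of all $b\ge 0$ for which such an $a\ge 0$ exists is the $T$-bound of $A$. The operator $T+A$ has domain $\mathcal D(T)$. The estimates include the assertion that the points $z$ in question belong to the resolvent set of $T+A$. *)

(* Defs.v *)
From HB Require Import structures.
From mathcomp Require Import all_boot all_order all_algebra.
From mathcomp Require Import sesquilinear complex.
From mathcomp Require Import all_classical all_reals all_analysis.

Set Implicit Arguments.
Unset Strict Implicit.
Unset Printing Implicit Defensive.

Import Order.TTheory GRing.Theory Num.Theory.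
Import numFieldNormedType.Exports.

Local Open Scope classical_set_scope.
Local Open Scope ring_scope.
Local Open Scope complex_scope.

(* The library norm of a normed module over R[i] takes its (nonnegative real)
   values in R[i]; rnorm is the same norm with values in R. *)
Definition rnorm (R : realType) (V : normedZmodType R[i]) (x : V) : R :=
  complex.Re `|x|.

(* A complex Hilbert space is a complete normed space over R[i] together with
   an inner product, linear in its first argument, that induces the norm. *)
Definition induces_norm (R : realType) (H : completeNormedModType R[i])
    (ip : {dot H for (@Num.conj R[i])}) : Prop :=
  forall x : H, `|x| ^+ 2 = ip x x.

(* The values of act outside dom are irrelevant. *)
Record linop (K : pzRingType) (H : lmodType K) := Linop {
  dom : set H;
  act :> H -> H;
  dom0 : dom 0;
  domP : forall (c : K) (x y : H), dom x -> dom y -> dom (c *: x + y);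
  actP : forall (c : K) (x y : H), dom x -> dom y ->
    act (c *: x + y) = c *: act x + act y
}.

Section Sum.
Variables (K : pzRingType) (H : lmodType K) (T A : linop H).

Lemma op_add_dom0 : (dom T `&` dom A) 0.
Proof. by split; exact: dom0. Qed.

Lemma op_add_domP (c : K) (x y : H) : (dom T `&` dom A) x ->
  (dom T `&` dom A) y -> (dom T `&` dom A) (c *: x + y).
Proof. by move=> [? ?] [? ?]; split; exact: domP. Qed.

Lemma op_add_actP (c : K) (x y : H) : (dom T `&` dom A) x ->
  (dom T `&` dom A) y ->
  T (c *: x + y) + A (c *: x + y) = c *: (T x + A x) + (T y + A y).
Proof. by move=> [? ?] [? ?]; rewrite !actP// scalerDr addrACA. Qed.

Definition op_add : linop H := Linop op_add_dom0 op_add_domP op_add_actP.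

Lemma dom_op_add : dom T `<=` dom A -> dom op_add = dom T.
Proof. exact: setIidl. Qed.

End Sum.

Definition op_graph (K : pzRingType) (H : lmodType K) (T : linop H) :
    set (H * H) :=
  [set p | dom T p.1 /\ T p.1 = p.2].

Section Operators.
Variables (R : realType) (H : completeNormedModType R[i]).
Implicit Types (T A : linop H) (z : R[i]).

(* The graph of T^*; it is the graph of a function when dom T is dense. *)
Definition adjoint_graph (ip : {dot H for (@Num.conj R[i])}) T :
    set (H * H) :=
  [set p | forall x, dom T x -> ip (T x) p.1 = ip x p.2].

Definition self_adjoint (ip : {dot H for (@Num.conj R[i])}) T : Prop :=
  dense (dom T) /\ op_graph T = adjoint_graph ip T.

Definition op_norm (S : H -> H) : \bar R :=
  ereal_sup [set (rnorm (S x))%:E | x in [set x | rnorm x <= 1]].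

Definition resolvent T z : H -> H :=
  fun y => xget 0 [set x | dom T x /\ T x - z *: x = y].

Definition resolvent_set T : set R[i] :=
  [set z | set_bij (dom T) setT (fun x => T x - z *: x) /\
           (op_norm (resolvent T z) < +oo)%E].

Definition spectrum T : set R[i] := ~` resolvent_set T.

Definition spectral_gap T (alpha beta : R) : Prop :=
  [/\ alpha < beta,
      spectrum T `&` [set t%:C | t in `]alpha, beta[] = set0,
      spectrum T alpha%:C & spectrum T beta%:C].

Definition rel_bound_pair T A (a b : R) : Prop :=
  forall x, dom T x ->
    rnorm (A x) ^+ 2 <= a ^+ 2 * rnorm x ^+ 2 + b ^+ 2 * rnorm (T x) ^+ 2.

Definition rel_bounded T A : Prop :=
  dom T `<=` dom A /\
  exists a b : R, [/\ 0 <= a, 0 <= b & rel_bound_pair T A a b].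

Definition rel_bound T A : R :=
  inf [set b | 0 <= b /\ exists2 a : R, 0 <= a & rel_bound_pair T A a b].

End Operators.

(* Main.v *)
(* If |A x| <= q |(T - z) x| on the domain of T with q < 1, then T + A - z is
   closed and |(T + A - z) x| >= (1 - q) |(T - z) x|; a vector e = (T - z) x
   orthogonal to its range satisfies |e|^2 = - Re <A x, e> <= q |e|^2, so
   T + A - z is onto.  It remains to find lower bounds for T - z and the
   constant q, which the spectral theorem would give at once; instead, only
   quadratic expressions in T are used.
   (i) With z = mu + i nu, |z|^2 |(T - z) x|^2 - nu^2 |T x|^2 equals
   |mu T x - |z|^2 x|^2.
   (ii) If (m - r, m + r) lies in the resolvent set, then
   |(T - m) x| >= r |x|: a best constant d < r would be improved by the
   lower bounds of T - m - d and T - m + d.  The quadratic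
   q^2 (t - Re z)^2 - a^2 - b^2 t^2 is then rewritten by completing the
   square. *)

Require Import Defs.
From HB Require Import structures.
From mathcomp Require Import all_boot all_order all_algebra.
From mathcomp Require Import sesquilinear complex.
From mathcomp Require Import all_classical all_reals all_analysis.
From mathcomp Require Import ring lra.

Set Implicit Arguments.
Unset Strict Implicit.
Unset Printing Implicit Defensive.

Import Order.TTheory GRing.Theory Num.Theory.
Import numFieldNormedType.Exports.

Local Open Scope classical_set_scope.
Local Open Scope ring_scope.
Local Open Scope complex_scope.

(** * The norm with real values *)

Section RealNorm.
Variables (R : realType) (V : normedZmodType R[i]).
Implicit Types x y : V.

Lemma rnormE x : (rnorm x)%:C = `|x|.
Proof. by rewrite /rnorm RRe_real. Qed.

Lemma rnorm_ge0 x : 0 <= rnorm x.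
Proof. by rewrite -lecR rnormE normr_ge0. Qed.

Lemma rnorm_eq0 x : (rnorm x == 0) = (x == 0).
Proof. by rewrite -(inj_eq (@complexI R)) rnormE normr_eq0. Qed.

Lemma ler_rnormD x y : rnorm (x + y) <= rnorm x + rnorm y.
Proof. by rewrite -lecR rmorphD /= !rnormE ler_normD. Qed.

Lemma rnormN x : rnorm (- x) = rnorm x.
Proof. by rewrite /rnorm normrN. Qed.

Lemma rnorm0 : rnorm (0 : V) = 0.
Proof. by rewrite /rnorm normr0. Qed.

Lemma rdistC x y : rnorm (x - y) = rnorm (y - x).
Proof. by rewrite -rnormN opprB. Qed.

Lemma ler_dist_rnorm x y : `|rnorm x - rnorm y| <= rnorm (x - y).
Proof.
rewrite ler_norml; apply/andP; split.
  by have := ler_rnormD (y - x) x; rewrite subrK rdistC; lra.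
by have := ler_rnormD (x - y) y; rewrite subrK; lra.
Qed.

End RealNorm.

Lemma rnormZ (R : realType) (V : normedModType R[i]) (z : R[i]) (x : V) :
  rnorm (z *: x) = rnorm z * rnorm x.
Proof. by apply: complexI; rewrite rmorphM /= !rnormE normrZ. Qed.

Lemma rnorm_real (R : realType) (c : R) : rnorm c%:C = `|c|.
Proof. by rewrite /rnorm normc_def /= expr0n addr0 sqrtr_sqr. Qed.

Lemma sqr_rnorm_complex (R : realType) (z : R[i]) :
  rnorm z ^+ 2 = complex.Re z ^+ 2 + complex.Im z ^+ 2.
Proof.
by rewrite /rnorm normc_def /= sqr_sqrtr// addr_ge0// sqr_ge0.
Qed.

(** * Norm convergence of sequences *)

Section Completeness.
Variables (R : realType) (H : completeNormedModType R[i]).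
Implicit Types (u : nat -> H) (l : H).

(** Convergence is phrased through a real sequence, so that order and limit lemmas over [R] apply;
    the topology of [H] over [R[i]] enters only in [complete_tends]. *)
Definition tends u l := (fun n => rnorm (u n - l)) @ \oo --> (0 : R).

Lemma tends_eventually u l (e : R) : tends u l -> 0 < e ->
  \forall n \near \oo, rnorm (u n - l) < e.
Proof.
move=> ul e0; have /cvgrPdist_lt/(_ _ e0) := ul.
by apply: filterS => n; rewrite sub0r normrN ger0_norm// rnorm_ge0.
Qed.

Lemma tendsP u l :
  (forall e : R, 0 < e -> \forall n \near \oo, rnorm (u n - l) < e) ->
  tends u l.
Proof.
move=> ul; apply/cvgrPdist_lt => e /ul; apply: filterS => n.
by rewrite sub0r normrN ger0_norm// rnorm_ge0.
Qed.

Lemma complete_tends u :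
  (forall e : R, 0 < e -> exists N, forall n m, (N <= n)%N -> (N <= m)%N ->
    rnorm (u n - u m) < e) -> exists l, tends u l.
Proof.
move=> uC; have /cauchy_cvgP cu : cauchy (u @ \oo).
  apply: cauchy_exP => e e0.
  (* Radii of balls in [H] lie in [R[i]]; a positive one is real. *)
  have eE : e = (complex.Re e)%:C by rewrite RRe_real// gtr0_real.
  move: e0; rewrite eE ltcR => e0; have [N HN] := uC _ e0.
  exists (u N); exists N => // n /= Nn.
  by rewrite -ball_normE /= -rnormE ltcR HN.
exists (lim (u @ \oo)); apply: tendsP => e e0.
have /cvgrPdist_lt/(_ e%:C) := cu; rewrite ltcR => /(_ e0).
by apply: filterS => n; rewrite -rnormE ltcR rdistC.
Qed.

Lemma tends_rnorm u l : tends u l -> rnorm (u n) @[n --> \oo] --> rnorm l.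
Proof.
move=> ul; apply/cvgrPdist_lt => e e0.
have := tends_eventually ul e0; apply: filterS => n.
by rewrite distrC; apply: le_lt_trans; exact: ler_dist_rnorm.
Qed.

Lemma tends_cst l : tends (fun=> l) l.
Proof. by rewrite /tends subrr rnorm0; exact: cvg_cst. Qed.

Lemma tendsD u v l k : tends u l -> tends v k -> tends (u \+ v) (l + k).
Proof.
move=> ul vk; apply: tendsP => e e0.
have e20 : 0 < e / 2 by rewrite divr_gt0.
near=> n; rewrite /= opprD addrACA (le_lt_trans (ler_rnormD _ _))//.
rewrite (splitr e) ltrD//.
  by near: n; exact: tends_eventually.
by near: n; exact: tends_eventually.
Unshelve. all: by end_near. Qed.

(** The constant sits on the side of [v], which is the form in which lower bounds of operators turn
    convergence of images into convergence of arguments. *)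
Lemma tends_dominated u v l k (c : R) : 0 < c -> tends u l ->
  (forall n, c * rnorm (v n - k) <= rnorm (u n - l)) -> tends v k.
Proof.
move=> c0 ul uv; apply: tendsP => e e0.
have := tends_eventually ul (mulr_gt0 c0 e0); apply: filterS => n ltn.
by rewrite -(ltr_pM2l c0); exact: le_lt_trans ltn.
Qed.

Lemma tendsZ u l z : tends u l -> tends (fun n => z *: u n) (z *: l).
Proof.
move=> ul; apply: (@tends_dominated u _ l _ (rnorm z + 1)^-1) => //.
  by rewrite invr_gt0 ltr_wpDl// rnorm_ge0.
move=> n; rewrite -scalerBr ler_pdivrMl ?ltr_wpDl ?rnorm_ge0//.
by rewrite rnormZ ler_wpM2r ?rnorm_ge0// lerDl.
Qed.

Lemma tendsN u l : tends u l -> tends (fun n => - u n) (- l).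
Proof.
move=> ul; apply: (tends_dominated ltr01 ul) => n.
by rewrite mul1r -opprD rnormN.
Qed.

Lemma tends_unique u l k : tends u l -> tends u k -> l = k.
Proof.
move=> ul uk; have lk : tends (fun=> 0) (l - k).
  apply: (tends_dominated ltr01 (tendsD ul (tendsN uk))) => n.
  by rewrite mul1r /= subrr.
apply/eqP; rewrite -subr_eq0 -rnorm_eq0; apply/eqP.
have := tends_rnorm lk; rewrite rnorm0 => h.
by apply: cvg_unique h _ => //; exact: cvg_cst.
Qed.

End Completeness.

(** * The underlying real inner product space *)

Section RealInnerProduct.
Variables (R : realType) (H : completeNormedModType R[i]).
Variable ip : {dot H for (@Num.conj R[i])}.
Hypothesis ip_norm : induces_norm ip.
Implicit Types (x y e : H) (c : R) (z : R[i]).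

(** The real part determines the whole inner product, because its imaginary part is recovered by
    multiplying an argument by ['i] ([rip_Im]). All estimates thus stay over [R]. *)
Definition rip x y : R := complex.Re (ip x y).

Lemma ripC x y : rip x y = rip y x.
Proof.
have ReJ (w : R[i]) : complex.Re (Num.conj w) = complex.Re w by case: w.
by rewrite /rip hermC expr0 mul1r; exact: ReJ.
Qed.

Lemma ripDl x y e : rip (x + y) e = rip x e + rip y e.
Proof.
have ReD (v w : R[i]) : complex.Re (v + w) = complex.Re v + complex.Re w.
  by case: v w => [? ?] [? ?].
by rewrite /rip linearDl; exact: ReD.
Qed.

Lemma ripDr x y e : rip e (x + y) = rip e x + rip e y.
Proof. by rewrite ripC ripDl !(ripC _ e). Qed.

Lemma ripNl x y : rip (- x) y = - rip x y.
Proof.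
have ReN (w : R[i]) : complex.Re (- w) = - complex.Re w by case: w.
by rewrite /rip linearNl; exact: ReN.
Qed.

Lemma ripNr x y : rip x (- y) = - rip x y.
Proof. by rewrite ripC ripNl ripC. Qed.

Lemma ripZl c x y : rip (c%:C *: x) y = c * rip x y.
Proof.
have ReZ (w : R[i]) : complex.Re (c%:C * w) = c * complex.Re w.
  by case: w => ? ? /=; rewrite mul0r subr0.
by rewrite /rip linearZl_LR; exact: ReZ.
Qed.

Lemma ripZr c x y : rip x (c%:C *: y) = c * rip x y.
Proof. by rewrite ripC ripZl ripC. Qed.

Lemma rip_Im x y : complex.Im (ip x y) = - rip ('i *: x) y.
Proof.
have Rei (w : R[i]) : complex.Im w = - complex.Re ('i%C * w).
  by case: w => ? ? /=; rewrite mul0r mul1r sub0r opprK.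
by rewrite /rip linearZl_LR; exact: Rei.
Qed.

Lemma ripiC x y : rip ('i *: x) y = - rip x ('i *: y).
Proof.
have ReiJ (w : R[i]) : complex.Re ('i%C * w) = - complex.Re (Num.conj 'i%C * w).
  by case: w => ? ? /=; rewrite !mul0r mulN1r mul1r opprK sub0r add0r.
by rewrite /rip linearZl_LR linearZr_LR; exact: ReiJ.
Qed.

Lemma sqr_rnorm x : rnorm x ^+ 2 = rip x x.
Proof.
apply: complexI; rewrite rmorphXn /= rnormE ip_norm /rip.
rewrite RRe_real//; apply: ger0_real; exact: dnorm_ge0.
Qed.

Lemma ripi x : rip x ('i *: x) = 0.
Proof. by have := ripiC x x; rewrite ripC; lra. Qed.

Lemma sqr_rnormD x y :
  rnorm (x + y) ^+ 2 = rnorm x ^+ 2 + 2 * rip x y + rnorm y ^+ 2.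
Proof. by rewrite !sqr_rnorm ripDl !ripDr (ripC y x); ring. Qed.

Lemma sqr_rnormB x y :
  rnorm (x - y) ^+ 2 = rnorm x ^+ 2 - 2 * rip x y + rnorm y ^+ 2.
Proof. by rewrite sqr_rnormD ripNr rnormN mulrN. Qed.

Lemma sqr_rnormZ c x : rnorm (c%:C *: x) ^+ 2 = c ^+ 2 * rnorm x ^+ 2.
Proof. by rewrite rnormZ rnorm_real exprMn real_normK// num_real. Qed.

Lemma rnormi x : rnorm ('i *: x) = rnorm x.
Proof.
rewrite rnormZ (_ : rnorm 'i = 1) ?mul1r//.
by rewrite /rnorm normc_def /= expr0n expr1n add0r sqrtr1.
Qed.

(** Cauchy-Schwarz: expand the squared norm of |y|^2 x - Re<x, y> y and divide by |y|^2. *)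
Lemma sqr_rip_le x y : rip x y ^+ 2 <= rnorm x ^+ 2 * rnorm y ^+ 2.
Proof.
have [->|y0] := eqVneq y 0.
  have /eqP := ripNr x 0; rewrite oppr0 -subr_eq0 opprK -mulr2n mulrn_eq0 /=.
  by move=> /eqP ->; rewrite rnorm0 expr0n mulr0.
have Ny : 0 < rnorm y ^+ 2 by rewrite exprn_gt0// lt_def rnorm_eq0 y0 rnorm_ge0.
have := sqr_ge0 (rnorm ((rnorm y ^+ 2)%:C *: x - (rip x y)%:C *: y)).
rewrite (sqr_rnormB (_ *: x)) !sqr_rnormZ ripZl ripZr.
rewrite (_ : _ + _ = rnorm y ^+ 2 *
  (rnorm x ^+ 2 * rnorm y ^+ 2 - rip x y ^+ 2)); last by ring.
by rewrite pmulr_rge0// subr_ge0.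
Qed.

Lemma tends_rip x (u : nat -> H) l : tends u l ->
  rip x (u n) @[n --> \oo] --> rip x l.
Proof.
move=> ul.
(* Polarization reduces continuity of the inner product to continuity of the norm. *)
have ripE y : rip x y = (rnorm (x + y) * rnorm (x + y)
    - rnorm x * rnorm x - rnorm y * rnorm y) / 2.
  by rewrite -!expr2 sqr_rnormD; field.
rewrite ripE; under eq_fun do rewrite ripE.
have xul := tends_rnorm (tendsD (tends_cst x) ul).
have ul' := tends_rnorm ul.
apply: cvgMl; apply: cvgB; last exact: cvgM.
by apply: cvgB; [exact: cvgM|exact: cvg_cst].
Qed.

End RealInnerProduct.

(** * Shifted operators and linearity on a domain *)

Section Shift.
Variables (K : comPzRingType) (H : lmodType K) (T : linop H) (z : K).

Lemma shift_actP (c : K) (x y : H) : dom T x -> dom T y ->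
  T (c *: x + y) - z *: (c *: x + y) = c *: (T x - z *: x) + (T y - z *: y).
Proof.
move=> Tx Ty; rewrite actP// scalerBr scalerDr opprD addrACA.
by rewrite scalerA mulrC scalerA.
Qed.

Definition op_shift : linop H := Linop (dom0 T) (@domP _ _ T) shift_actP.

End Shift.

Section LinopTheory.
Variables (K : pzRingType) (H : lmodType K) (L : linop H).
Implicit Types (x y : H) (c : K).

Lemma act0 : L 0 = 0.
Proof.
have := actP (-1) (dom0 L) (dom0 L).
by rewrite scaler0 addr0 scaleN1r addNr.
Qed.

Lemma domZ c x : dom L x -> dom L (c *: x).
Proof.
by move=> Lx; rewrite -[_ *: _]addr0; apply: domP => //; exact: dom0.
Qed.

Lemma domD x y : dom L x -> dom L y -> dom L (x + y).
Proof. by move=> Lx Ly; rewrite -[x]scale1r; exact: domP. Qed.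

Lemma domB x y : dom L x -> dom L y -> dom L (x - y).
Proof. by move=> Lx Ly; rewrite addrC -scaleN1r; exact: domP. Qed.

Lemma actZ c x : dom L x -> L (c *: x) = c *: L x.
Proof.
move=> Lx; rewrite -[_ *: x]addr0 actP//; last exact: dom0.
by rewrite act0 addr0.
Qed.

Lemma actD x y : dom L x -> dom L y -> L (x + y) = L x + L y.
Proof. by move=> Lx Ly; rewrite -[in LHS](scale1r x) actP// scale1r. Qed.

Lemma actB x y : dom L x -> dom L y -> L (x - y) = L x - L y.
Proof. by move=> Lx Ly; rewrite addrC -scaleN1r actP// scaleN1r addrC. Qed.

End LinopTheory.

(** * Orthogonal projection onto the range, and surjectivity *)

Section Range.
Variables (R : realType) (H : completeNormedModType R[i]).
Variable ip : {dot H for (@Num.conj R[i])}.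
Hypothesis ip_norm : induces_norm ip.
Variable L : linop H.

(* Minimizing sequences for the distance to the range are Cauchy by the
   parallelogram law. *)
Lemma range_projection w : exists (x : nat -> H) v,
  [/\ forall n, dom L (x n), tends (fun n => L (x n)) v &
      forall u, dom L u -> rip ip (L u) (w - v) = 0].
Proof.
pose E := [set rnorm (w - L x) ^+ 2 | x in dom L].
have E0 : E !=set0 by exists (rnorm (w - L 0) ^+ 2), 0 => //; exact: dom0.
have lbE : has_lbound E by exists 0 => _ [x _ <-]; exact: sqr_ge0.
have infE : has_inf E by split.
pose d := inf E.
have dE x : dom L x -> d <= rnorm (w - L x) ^+ 2.
  by move=> Lx; apply: ge_inf => //; exists x.
have /choice[x xP] (n : nat) :
    exists x, dom L x /\ rnorm (w - L x) ^+ 2 < d + n.+1%:R^-1.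
  have n0 : 0 < n.+1%:R^-1 :> R by rewrite invr_gt0.
  by have [_ [x Lx <-]] := inf_adherent n0 infE; exists x.
have xn n := (xP n).1; have dx n := (xP n).2.
have [v xv] : exists v, tends (fun n => L (x n)) v.
  apply: complete_tends => e e0.
  have e20 : 0 < e ^+ 2 / 4 by rewrite divr_gt0// exprn_gt0.
  have [N _ HN] := near_infty_natSinv_lt (PosNum e20).
  exists N => n m /HN/= ltn /HN/= ltm.
  rewrite -(@ltr_pXn2r _ 2)// ?nnegrE ?rnorm_ge0 ?ltW//.
  (* The midpoint of [x n] and [x m] is a competitor, so its image is at squared distance at least
     [d]; the parallelogram law then leaves |L x_n - L x_m|^2 <= 2/(n+1) + 2/(m+1) < e^2. *)
  have := dE _ (domD (domZ (2^-1)%:C (xn n)) (domZ (2^-1)%:C (xn m))).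
  rewrite actD ?actZ; do ?[exact: xn|exact: domZ].
  have -> : w - ((2^-1)%:C *: L (x n) + (2^-1)%:C *: L (x m)) =
      (2^-1)%:C *: ((w - L (x n)) + (w - L (x m))).
    rewrite !scalerDr !scalerN addrACA -opprD; congr (_ - _).
    by rewrite -scalerDl -rmorphD/= (_ : 2^-1 + 2^-1 = 1) ?scale1r//; lra.
  have -> : L (x n) - L (x m) = (w - L (x m)) - (w - L (x n)).
    by rewrite opprB [RHS]addrC addrA subrK.
  rewrite sqr_rnormZ (sqr_rnormD ip_norm (w - L (x n))).
  rewrite (sqr_rnormB ip_norm (w - L (x m))) (ripC ip (w - L (x m))).
  move: (dx n) (dx m) ltn ltm => /=.
  rewrite (_ : 2^-1 ^+ 2 = 4^-1 :> R); last by field.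
  move: (rip _ _ _) (rnorm (w - L (x m)) ^+ 2) (rnorm (w - L (x n)) ^+ 2).
  move: (n.+1%:R^-1) (m.+1%:R^-1) (e ^+ 2) => i j s p q r; lra.
exists x, v; split => // u Lu.
have wv := tendsD (tends_cst w) (tendsN xv).
have lim_dx : rnorm (w - v) ^+ 2 <= d.
  apply: (@ler_cvg_to _ \oo _ _ (fun n => rnorm (w - L (x n)) ^+ 2)
    (fun n => d + n.+1%:R^-1)); last by near=> n; exact: ltW.
    rewrite expr2; under eq_fun do rewrite expr2.
    by apply: cvgM; exact: tends_rnorm wv.
  rewrite -[X in _ --> X]addr0; apply: cvgD; first exact: cvg_cst.
  exact: cvg_harmonic.
have lim_t (t : R) : d <= rnorm (w - v + t%:C *: L u) ^+ 2.
  have wvt := tendsD wv (tends_cst (t%:C *: L u)).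
  apply: (@ler_cvg_to _ \oo _ _ (fun=> d)
    (fun n => rnorm (w - L (x n) + t%:C *: L u) ^+ 2)).
  - exact: cvg_cst.
  - rewrite expr2; under [X in X @ _]eq_fun do rewrite expr2.
    by apply: cvgM; exact: tends_rnorm wvt.
  - near=> n; have -> : w - L (x n) + t%:C *: L u = w - L (x n - t%:C *: u).
      by rewrite actB ?actZ ?opprB ?addrA//; [rewrite addrAC|exact: domZ].
    by apply: dE; apply: domB => //; exact: domZ.
(* First variation: moving from [v] along [L u] cannot decrease the distance to [w], for [t] of
   either sign. *)
have {lim_dx lim_t} : forall t : R,
    0 <= 2 * t * rip ip (L u) (w - v) + t ^+ 2 * rnorm (L u) ^+ 2.
  move=> t; have := le_trans lim_dx (lim_t t).
  by rewrite (sqr_rnormD ip_norm (w - v)) sqr_rnormZ ripZr ripC; lra.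
move: (rip _ _ _) (rnorm _) => r k h.
have k1 : 0 < k ^+ 2 + 1 by rewrite ltr_wpDl ?sqr_ge0.
(* Nearly the minimizer -r / k^2; the added 1 keeps the denominator nonzero when [L u] vanishes. *)
have := h (- r / (k ^+ 2 + 1)).
have -> : 2 * (- r / (k ^+ 2 + 1)) * r + (- r / (k ^+ 2 + 1)) ^+ 2 * k ^+ 2 =
   - (r ^+ 2 * (k ^+ 2 + 2) / (k ^+ 2 + 1) ^+ 2).
  by field; rewrite gt_eqF.
rewrite oppr_ge0 ler_pdivrMr ?exprn_gt0// mul0r pmulr_lle0; last first.
  by rewrite ltr_wpDl ?sqr_ge0.
by move=> r0; apply/eqP; rewrite -sqrf_eq0 eq_le r0 sqr_ge0.
Unshelve. all: by end_near. Qed.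

Definition closed_op := forall (x : nat -> H) l y, (forall n, dom L (x n)) ->
  tends x l -> tends (fun n => L (x n)) y -> dom L l /\ L l = y.

Lemma tends_bounded_below (c : R) (x : nat -> H) y : 0 < c ->
  (forall u, dom L u -> c * rnorm u <= rnorm (L u)) ->
  (forall n, dom L (x n)) -> tends (fun n => L (x n)) y -> exists l, tends x l.
Proof.
move=> c0 cL xD Lxy; apply: complete_tends => e e0.
have ce0 : 0 < c * e / 2 by rewrite divr_gt0// mulr_gt0.
have [N _ HN] := tends_eventually Lxy ce0.
exists N => n m /HN/= ltn /HN/= ltm.
rewrite -(ltr_pM2l c0) (le_lt_trans (cL _ (domB (xD n) (xD m))))// actB//.
have -> : L (x n) - L (x m) = (L (x n) - y) + (y - L (x m)).
  by rewrite addrA subrK.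
by rewrite (le_lt_trans (ler_rnormD _ _))// (rdistC y); lra.
Qed.

(** Closedness and the lower bound make the projection [v] of [w] an actual value of [L]; the
    residual [w - v] is orthogonal to the range, hence zero. *)
Lemma closed_surjective (c : R) : 0 < c -> closed_op ->
  (forall u, dom L u -> c * rnorm u <= rnorm (L u)) ->
  (forall e, (forall u, dom L u -> rip ip (L u) e = 0) -> e = 0) ->
  forall w, exists2 x, dom L x & L x = w.
Proof.
move=> c0 clL cL orthL w.
have [x [v [xD Lxv vP]]] := range_projection w.
have [l xl] := tends_bounded_below c0 cL xD Lxv.
have [Ll Llv] := clL _ _ _ xD xl Lxv.
by exists l => //; apply/eqP; rewrite Llv eq_sym -subr_eq0 (orthL _ vP).
Qed.

End Range.

(** * Self-adjoint operators and their shifts *)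

Section SelfAdjoint.
Variables (R : realType) (H : completeNormedModType R[i]).
Variable ip : {dot H for (@Num.conj R[i])}.
Hypothesis ip_norm : induces_norm ip.
Variable T : linop H.
Hypothesis T_sa : self_adjoint ip T.
Implicit Types (x y e : H) (z : R[i]).

Lemma rip_conj z x y : rip ip (z *: x) y = rip ip x (z^* *: y).
Proof.
have ReJ (w : R[i]) : complex.Re (z * w) = complex.Re (Num.conj (z^*) * w).
  by case: z w => [? ?] [? ?] /=; rewrite opprK.
by rewrite /rip linearZl_LR linearZr_LR; exact: ReJ.
Qed.

Lemma sa_symmetric x y : dom T x -> dom T y ->
  rip ip (T x) y = rip ip x (T y).
Proof.
move=> Tx Ty; have : op_graph T (y, T y) by [].
by rewrite T_sa.2 => /(_ x Tx) /= xyE; rewrite /rip xyE.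
Qed.

(** Testing real parts suffices to land in the graph of the adjoint: the imaginary part is the same
    test at ['i *: u], which is again in the domain. *)
Lemma sa_maximal x y : (forall u, dom T u -> rip ip (T u) x = rip ip u y) ->
  dom T x /\ T x = y.
Proof.
move=> xy; suff : op_graph T (x, y) by [].
rewrite T_sa.2 => u Tu /=; apply/eqP; rewrite eq_complex !rip_Im.
by rewrite -!/(rip ip _ _) (xy _ Tu) -actZ// xy ?eqxx//; exact: domZ.
Qed.

(** The equations defining the adjoint graph pass to the limit, and that graph is the graph of
    [T]. *)
Lemma sa_shift_closed z : closed_op (op_shift T z).
Proof.
move=> x l y /= xD xl Txl.
have Ty : tends (fun n => T (x n)) (y + z *: l).
  apply: (tends_dominated ltr01 (tendsD Txl (tendsZ z xl))) => n.
  by rewrite mul1r /= subrK.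
suff [Tl TlE] : dom T l /\ T l = y + z *: l by split => //; rewrite TlE addrK.
apply: sa_maximal => u Tu.
have h1 := tends_rip ip_norm (x := T u) xl.
have h2 := tends_rip ip_norm (x := u) Ty.
have h : (fun n => rip ip (T u) (x n)) = (fun n => rip ip u (T (x n))).
  by apply/funext => n; exact: sa_symmetric.
by move: h1; rewrite h => h1; apply: cvg_unique h1 h2.
Qed.

(** The cross term is a multiple of Re<(T - Re z) x, i x>, which vanishes by symmetry. *)
Lemma sqr_rnorm_shift z x : dom T x ->
  rnorm (op_shift T z x) ^+ 2 = rnorm (op_shift T (complex.Re z)%:C x) ^+ 2
    + complex.Im z ^+ 2 * rnorm x ^+ 2.
Proof.
move=> Tx /=.
have -> : T x - z *: x = (T x - (complex.Re z)%:C *: x)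
    - (complex.Im z)%:C *: ('i *: x).
  by rewrite [in LHS](complexE z) scalerDl opprD addrA scalerA mulrC.
rewrite (sqr_rnormB ip_norm (T x - _)) sqr_rnormZ rnormi ripZr ripDl ripNl.
rewrite ripZl ripi.
suff -> : rip ip (T x) ('i *: x) = 0 by ring.
have := sa_symmetric Tx (domZ 'i Tx).
by rewrite actZ// -[RHS]opprK -ripiC ripC; lra.
Qed.

Lemma rnorm_shift_ge_Im z x : dom T x ->
  `|complex.Im z| * rnorm x <= rnorm (op_shift T z x).
Proof.
move=> Tx; rewrite -(@ler_pXn2r _ 2)// ?nnegrE ?mulr_ge0 ?rnorm_ge0//.
by rewrite sqr_rnorm_shift// exprMn real_normK ?num_real// lerDr sqr_ge0.
Qed.

Lemma sa_orth_range z e :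
  (forall u, dom T u -> rip ip (op_shift T z u) e = 0) ->
  dom T e /\ op_shift T z^* e = 0.
Proof.
move=> he; suff [Te TeE] : dom T e /\ T e = z^* *: e.
  by split=> //=; rewrite TeE subrr.
apply: sa_maximal => u Tu; rewrite -rip_conj.
by apply/eqP; rewrite -subr_eq0 -ripNl -ripDl he.
Qed.

(** A vector orthogonal to the range is in the kernel of T - conj z, which is trivial because
    conjugation preserves |Im z|. *)
Lemma sa_shift_surjective z : complex.Im z != 0 ->
  forall w, exists2 x, dom T x & op_shift T z x = w.
Proof.
move=> z0 w.
have z1 : 0 < `|complex.Im z| by rewrite normr_gt0.
apply: (closed_surjective ip_norm z1 (@sa_shift_closed z)) => [u Tu|e he].
  exact: rnorm_shift_ge_Im.
have [Te Te0] := sa_orth_range he; apply/eqP.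
have := rnorm_shift_ge_Im z^* Te; rewrite Te0 rnorm0.
have -> : `|complex.Im z^*| = `|complex.Im z|.
  by case: (z) => ? ? /=; rewrite normrN.
by rewrite pmulr_rle0// -rnorm_eq0 eq_le rnorm_ge0 andbT.
Qed.

End SelfAdjoint.

(** * Resolvent set and lower bounds *)

Section Resolvent.
Variables (R : realType) (H : completeNormedModType R[i]).
Implicit Types (L : linop H) (z : R[i]).

Lemma resolvent_bound L z (c : R) : 0 < c ->
  (forall x, dom L x -> c * rnorm x <= rnorm (op_shift L z x)) ->
  (forall w, exists2 x, dom L x & op_shift L z x = w) ->
  resolvent_set L z /\ (op_norm (resolvent L z) <= (1 / c)%:E)%E.
Proof.
move=> c0 cL surjL.
have nL : (op_norm (resolvent L z) <= (1 / c)%:E)%E.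
  apply: ge_ereal_sup => _ [y /= y1 <-]; rewrite lee_fin ler_pdivlMr// mulrC.
  (* [xget] yields either a preimage of [y] or its default 0, for which the bound is trivial. *)
  apply: le_trans y1; rewrite /resolvent; case: xgetP => [x _ [Lx <-]|_].
    exact: cL.
  by rewrite rnorm0 mulr0 rnorm_ge0.
split=> //; split; last exact: le_lt_trans nL (ltry _).
split => //.
- move=> x y /set_mem Lx /set_mem Ly xy.
  apply/eqP; rewrite -subr_eq0 -rnorm_eq0 eq_le rnorm_ge0 andbT.
  rewrite -(pmulr_rle0 _ c0) (le_trans (cL _ (domB Lx Ly)))// actB//=.
  by rewrite xy subrr rnorm0.
- by move=> w _; have [x Lx <-] := surjL w; exists x.
Qed.

Lemma resolvent_set_surjective L z : resolvent_set L z ->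
  forall w, exists2 x, dom L x & op_shift L z x = w.
Proof. by case=> -[_ _ surjL] _ w; have [//|x] := surjL w; exists x. Qed.

Lemma resolvent_set_bounded_below L z : resolvent_set L z ->
  exists2 c : R, 0 < c &
    forall x, dom L x -> c * rnorm x <= rnorm (op_shift L z x).
Proof.
case=> -[_ injL _] bL.
set M := op_norm _ in bL.
have rM y : rnorm y <= 1 -> ((rnorm (resolvent L z y))%:E <= M)%E.
  by move=> y1; apply: ereal_sup_ubound; exists y.
have M0 : (0 <= M)%E.
  by apply: le_trans (rM 0 _); rewrite ?lee_fin ?rnorm_ge0// rnorm0.
have Mf : M \is a fin_num by rewrite ge0_fin_numE.
(* The added 1 makes [m] invertible even if the resolvent has norm 0, as on the zero space. *)
pose m := fine M + 1.
have m0 : 0 < m by rewrite ltr_wpDl// fine_ge0.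
exists m^-1; rewrite ?invr_gt0// => x Lx.
have resE y : dom L y -> resolvent L z (op_shift L z y) = y.
  move=> Ly; rewrite /resolvent; case: xgetP => [x' _ [Lx' x'E]|/(_ y)[]//].
  by apply: injL => //; exact/mem_set.
pose k := rnorm (op_shift L z x).
have [k0|k0] := eqVneq k 0.
  suff -> : x = 0 by rewrite rnorm0 mulr0 rnorm_ge0.
  apply: injL; [exact/mem_set|exact/mem_set/dom0|].
  by rewrite act0 scaler0 subr0; apply/eqP; rewrite -rnorm_eq0; apply/eqP.
have kgt0 : 0 < k by rewrite lt_def k0 rnorm_ge0.
rewrite ler_pdivrMl// -ler_pdivrMr// mulrC.
(* [op_norm] is a supremum over the unit ball, so the image of [x] is normalized first. *)
have := rM (op_shift L z ((k^-1)%:C *: x)).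
rewrite resE; last exact: domZ.
rewrite (actZ (L := op_shift L z))// !rnormZ rnorm_real gtr0_norm ?invr_gt0//.
rewrite -/k mulVf// lexx -[M]fineK// lee_fin => /(_ isT) /le_trans; apply.
by rewrite lerDl.
Qed.
End Resolvent.

(** * Stability of the resolvent under a relatively small perturbation *)

Section Perturbation.
Variables (R : realType) (H : completeNormedModType R[i]).
Variable ip : {dot H for (@Num.conj R[i])}.
Hypothesis ip_norm : induces_norm ip.
Variables (T A : linop H) (z : R[i]) (c q : R).
Hypothesis T_sa : self_adjoint ip T.
Hypothesis TA : dom T `<=` dom A.
Hypotheses (c_gt0 : 0 < c) (q_ge0 : 0 <= q) (q_lt1 : q < 1).
Hypothesis T_ge : forall x, dom T x -> c * rnorm x <= rnorm (op_shift T z x).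
Hypothesis T_surj : forall w, exists2 x, dom T x & op_shift T z x = w.
Hypothesis A_le : forall x, dom T x ->
  rnorm (A x) <= q * rnorm (op_shift T z x).

Let S := op_shift (op_add T A) z.
Let SE x : S x = op_shift T z x + A x.
Proof. by rewrite /S /= addrAC. Qed.

Lemma perturbed_ge x : dom T x ->
  (1 - q) * rnorm (op_shift T z x) <= rnorm (S x).
Proof.
move=> Tx; have := ler_rnormD (S x) (- A x).
by rewrite rnormN SE addrK; have := A_le Tx; lra.
Qed.

(** By [perturbed_ge], convergence of [S (x n)] makes (T - z) x_n Cauchy. Closedness of T - z then
    puts [l] in the domain, and the bound on [A] gives convergence of [S (x n)] to [S l]. *)
Lemma perturbed_closed : closed_op S.
Proof.
move=> x l y xD xl Sxy.
have TD n : dom T (x n) by have [] := xD n.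
have q1 : 0 < 1 - q by rewrite subr_gt0.
have [v Tv] : exists v, tends (fun n => op_shift T z (x n)) v.
  apply: complete_tends => e e0.
  have e20 : 0 < (1 - q) * e / 2 by rewrite divr_gt0// mulr_gt0.
  have [N _ HN] := tends_eventually Sxy e20.
  have {}HN k : (N <= k)%N -> rnorm (S (x k) - y) < (1 - q) * e / 2.
    exact: HN.
  exists N => n m /HN ltn /HN ltm.
  rewrite -(ltr_pM2l q1) -(actB (L := op_shift T z) (TD n) (TD m)).
  apply: le_lt_trans (perturbed_ge (domB (TD n) (TD m))) _.
  rewrite (actB (xD n) (xD m)).
  have -> : S (x n) - S (x m) = (S (x n) - y) + (y - S (x m)).
    by rewrite addrA subrK.
  apply: le_lt_trans (ler_rnormD _ _) _.
  by rewrite (rdistC y) [ltRHS]splitr ltrD.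
have [Tl Tlv] := sa_shift_closed ip_norm T_sa TD xl Tv.
have Sl : dom S l by split => //; exact: TA.
split => //; apply: tends_unique _ Sxy.
(* From |S u| <= (1 + q) |(T - z) u|. *)
have q1' : 0 < (1 + q)^-1 by rewrite invr_gt0 ltr_pwDl.
apply: (tends_dominated q1' Tv) => n.
rewrite -Tlv -(actB (xD n) Sl) -(actB (L := op_shift T z) (TD n) Tl).
rewrite ler_pdivrMl ?ltr_pwDl// SE (le_trans (ler_rnormD _ _))//.
by rewrite mulrDl mul1r lerD2l; exact: A_le (domB (TD n) Tl).
Qed.

Lemma perturbed_orth_range e :
  (forall u, dom T u -> rip ip (S u) e = 0) -> e = 0.
Proof.
move=> he; have [x Tx xe] := T_surj e.
have := he x Tx; rewrite SE ripDl xe -sqr_rnorm//.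
have := A_le Tx; rewrite xe => Axe.
have := sqr_rnormD ip_norm (A x) e.
have := sqr_ge0 (rnorm (A x + e)).
have Axe2 : rnorm (A x) ^+ 2 <= (q * rnorm e) ^+ 2.
  by rewrite ler_pXn2r ?nnegrE ?mulr_ge0 ?rnorm_ge0.
move: Axe2; rewrite exprMn => Axe2 h1 h2 h3.
(* Since Re<A x, e> = -|e|^2, expanding |A x + e|^2 >= 0 gives |e|^2 <= |A x|^2 <= q^2 |e|^2. *)
have h4 : (1 - q ^+ 2) * rnorm e ^+ 2 <= 0 by lra.
have q21 : 0 < 1 - q ^+ 2 by rewrite subr_gt0 expr_lt1.
apply/eqP; rewrite -rnorm_eq0 -sqrf_eq0 eq_le sqr_ge0 andbT.
by rewrite -(pmulr_rle0 _ q21).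
Qed.

Lemma perturbed_resolvent : resolvent_set (op_add T A) z /\
  (op_norm (resolvent (op_add T A) z) <= (1 / ((1 - q) * c))%:E)%E.
Proof.
have q1 : 0 < 1 - q by rewrite subr_gt0.
have S_ge x : dom S x -> (1 - q) * c * rnorm x <= rnorm (S x).
  case=> Tx _; apply: le_trans (perturbed_ge Tx).
  by rewrite -mulrA ler_pM2l// T_ge.
apply: resolvent_bound => //; first exact: mulr_gt0.
apply: (closed_surjective ip_norm (mulr_gt0 q1 c_gt0) perturbed_closed) => //.
by move=> e he; apply: perturbed_orth_range => u Tu;
  apply: he; split => //; exact: TA.
Qed.

End Perturbation.

(** * Improving a lower bound at a real point *)

Section Gap.
Variables (R : realType) (H : completeNormedModType R[i]).
Variable ip : {dot H for (@Num.conj R[i])}.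
Hypothesis ip_norm : induces_norm ip.
Variable T : linop H.
Hypothesis T_sa : self_adjoint ip T.
Variable m : R.

Lemma sqr_rnorm_real_shift (t : R) x : dom T x ->
  rnorm (op_shift T t%:C x) ^+ 2 =
  rnorm (T x) ^+ 2 - 2 * t * rip ip (T x) x + t ^+ 2 * rnorm x ^+ 2.
Proof.
move=> Tx /=.
by rewrite (sqr_rnormB ip_norm (T x)) sqr_rnormZ ripZr; ring.
Qed.

Let B := op_shift T m%:C.

Lemma real_shift_symmetric x y : dom T x -> dom T y ->
  rip ip (B x) y = rip ip x (B y).
Proof.
move=> Tx Ty; rewrite /B /= ripDl ripDr ripNl ripNr ripZl ripZr.
by rewrite (sa_symmetric T_sa).
Qed.

Lemma real_shiftD (d : R) x : B x - d%:C *: x = op_shift T (m + d)%:C x.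
Proof. by rewrite /B /= rmorphD /= scalerDl opprD addrA. Qed.

(* With x = B w and y = B x, one has (B - d) (B + d) w = y - d^2 w, whose
   squared norm is at most |y|^2 - d^2 |x|^2. *)
Lemma lower_bound_improves (d c : R) : 0 < c ->
  (forall w, exists2 x, dom T x & B x = w) ->
  (forall x, dom T x -> d * rnorm x <= rnorm (B x)) ->
  (forall x, dom T x -> c * rnorm x <= rnorm (op_shift T (m - d)%:C x)) ->
  (forall x, dom T x -> c * rnorm x <= rnorm (op_shift T (m + d)%:C x)) ->
  0 <= d ->
  forall x, dom T x ->
    c ^+ 4 * rnorm x ^+ 4 <=
      (rnorm (B x) ^+ 2 - d ^+ 2 * rnorm x ^+ 2) * rnorm (B x) ^+ 2.
Proof.
move=> c0 surjB dB cm cp d0 x Tx.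
have [w Tw wx] := surjB x.
set y := B x.
have yw : rip ip y w = rnorm x ^+ 2.
  by rewrite /y real_shift_symmetric// wx -sqr_rnorm.
have dw : d ^+ 2 * rnorm w ^+ 2 <= rnorm x ^+ 2.
  rewrite -exprMn -wx ler_pXn2r ?nnegrE ?mulr_ge0 ?rnorm_ge0//.
  exact: dB.
(* This is (B + d) w, so the bound at m - d applies to [w] and the one at m + d to [v]. *)
pose v := x + d%:C *: w.
have Tv : dom T v by apply: domD => //; exact: domZ.
have vE : op_shift T (m - d)%:C w = v.
  by rewrite -real_shiftD wx rmorphN scaleNr opprK.
have yE : op_shift T (m + d)%:C v = y - (d ^+ 2)%:C *: w.
  rewrite -real_shiftD /v (actD (L := B))//; last exact: domZ.
  rewrite (actZ (L := B))// wx -/y scalerDr opprD addrA addrK.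
  by rewrite scalerA -rmorphM -expr2.
have h1 : c ^+ 2 * rnorm w ^+ 2 <= rnorm v ^+ 2.
  by rewrite -exprMn -vE ler_pXn2r ?nnegrE ?mulr_ge0 ?rnorm_ge0 ?(ltW c0)// cm.
have h2 : c ^+ 2 * rnorm v ^+ 2 <= rnorm y ^+ 2 - d ^+ 2 * rnorm x ^+ 2.
  apply: (@le_trans _ _ (rnorm (op_shift T (m + d)%:C v) ^+ 2)).
    by rewrite -exprMn ler_pXn2r ?nnegrE ?mulr_ge0 ?rnorm_ge0 ?(ltW c0)// cp.
  (* The square is |y|^2 - 2 d^2 |x|^2 + d^4 |w|^2, and [dw] absorbs the last term into half of the
     cross term. *)
  rewrite yE (sqr_rnormB ip_norm y) sqr_rnormZ ripZr yw.
  have := ler_wpM2l (sqr_ge0 d) dw; lra.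
(* Cauchy-Schwarz applied to [yw]; this eliminates the auxiliary vector [w]. *)
have h3 : rnorm x ^+ 4 <= rnorm y ^+ 2 * rnorm w ^+ 2.
  by have := sqr_rip_le ip_norm y w; rewrite yw -exprM.
have h4 := le_trans (ler_wpM2l (sqr_ge0 c) h1) h2.
have c4 : 0 <= c ^+ 4 by rewrite exprn_ge0// ltW.
apply: le_trans (ler_wpM2l c4 h3) _.
apply: le_trans (ler_wpM2r (sqr_ge0 (rnorm y)) h4).
by rewrite le_eqVlt; apply/orP; left; apply/eqP; ring.
Qed.
End Gap.

(** * Lower bounds and relative bounds from a spectral gap *)

Section SpectralGap.
Variables (R : realType) (H : completeNormedModType R[i]).
Variable ip : {dot H for (@Num.conj R[i])}.
Hypothesis ip_norm : induces_norm ip.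
Variable T : linop H.
Hypothesis T_sa : self_adjoint ip T.

Lemma gap_lower_bound (m r : R) : 0 <= r ->
  (forall t, m - r < t -> t < m + r -> resolvent_set T t%:C) ->
  forall x, dom T x -> r * rnorm x <= rnorm (op_shift T m%:C x).
Proof.
rewrite le_eqVlt => /orP[/eqP<- _ x _|r0 gap]; first by rewrite mul0r rnorm_ge0.
(* The cap d <= r keeps the set bounded above even on the zero space, where every constant works. *)
pose E := [set d | [/\ 0 <= d, d <= r &
  forall x, dom T x -> d * rnorm x <= rnorm (op_shift T m%:C x)]].
have E0 : E 0 by split => // [|x _]; [exact: ltW|rewrite mul0r rnorm_ge0].
have ubE : has_ubound E by exists r => d [].
have supE : has_sup E by split; first exists 0.
pose d := sup E.
have d0 : 0 <= d by apply: ub_le_sup.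
have dr : d <= r by apply: ge_sup => [|e []//]; exists 0.
have dE x : dom T x -> d * rnorm x <= rnorm (op_shift T m%:C x).
  move=> Tx; have [->|x0] := eqVneq (rnorm x) 0.
    by rewrite mulr0 rnorm_ge0.
  have xgt0 : 0 < rnorm x by rewrite lt_def x0 rnorm_ge0.
  rewrite -ler_pdivlMr//; apply: ge_sup; first by exists 0.
  by move=> e [_ _ eE]; rewrite ler_pdivlMr//; exact: eE.
move: dr; rewrite le_eqVlt => /orP[/eqP<-//|dr].
have gap_at t : `|t - m| < r ->
    exists2 c : R, 0 < c &
      forall x, dom T x -> c * rnorm x <= rnorm (op_shift T t%:C x).
  rewrite ltr_norml => /andP[h1 h2].
  by apply: resolvent_set_bounded_below; apply: gap; lra.
have [|c1 c10 hc1] := gap_at (m - d).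
  by rewrite addrAC subrr sub0r normrN ger0_norm.
have [|c2 c20 hc2] := gap_at (m + d).
  by rewrite addrAC subrr add0r ger0_norm.
pose c := Num.min c1 c2.
have c0 : 0 < c by rewrite lt_min c10.
have surjm : forall w, exists2 x, dom T x & op_shift T m%:C x = w.
  by apply: resolvent_set_surjective; apply: gap; lra.
have imp := lower_bound_improves ip_norm T_sa c0 surjm dE _ _ d0.
have {}imp : forall x, dom T x -> c ^+ 4 * rnorm x ^+ 4 <=
    (rnorm (op_shift T m%:C x) ^+ 2 - d ^+ 2 * rnorm x ^+ 2) *
    rnorm (op_shift T m%:C x) ^+ 2.
  apply: imp => x Tx.
    by apply: le_trans (hc1 x Tx); rewrite ler_wpM2r ?rnorm_ge0// ge_min lexx.
  apply: le_trans (hc2 x Tx).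
  by rewrite ler_wpM2r ?rnorm_ge0// ge_min lexx orbT.
(* A squared constant exceeding d^2. If |B x|^2 < s |x|^2, with B = T - m, then |B x|^2 - d^2 |x|^2
   <= c^4 |x|^2 / r^2 and |B x|^2 < r^2 |x|^2, whose product contradicts [imp]. *)
pose s := Num.min (r ^+ 2) (d ^+ 2 + c ^+ 4 / r ^+ 2).
have r20 : 0 < r ^+ 2 by rewrite exprn_gt0.
have s_gt : d ^+ 2 < s.
  rewrite lt_min ltr_pXn2r ?nnegrE ?(ltW r0)// dr /=.
  by rewrite ltrDl divr_gt0// exprn_gt0.
have s0 : 0 <= s by apply: le_trans (ltW s_gt); exact: sqr_ge0.
have sr : s <= r ^+ 2 by rewrite ge_min lexx.
have sc : s <= d ^+ 2 + c ^+ 4 / r ^+ 2 by rewrite ge_min lexx orbT.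
have Es : E (Num.sqrt s).
  split; first exact: sqrtr_ge0.
    by rewrite -(ler_pXn2r (n := 2))// ?nnegrE ?sqrtr_ge0 ?(ltW r0)// sqr_sqrtr.
  move=> x Tx; rewrite leNgt; apply/negP => lt_s.
  have x0 : 0 < rnorm x.
    rewrite lt_def rnorm_ge0 andbT; apply/eqP => x0.
    by move: lt_s; rewrite x0 mulr0 ltNge rnorm_ge0.
  have := imp x Tx; move: lt_s (rnorm_ge0 (op_shift T m%:C x)).
  move: (rnorm _) (rnorm x) x0 => y n n0 lt_s y0.
  have y2 : y ^+ 2 < s * n ^+ 2.
    rewrite -[s]sqr_sqrtr// -exprMn ltr_pXn2r// ?nnegrE// mulr_ge0 ?sqrtr_ge0//.
    exact: ltW.
  have n20 : 0 < n ^+ 2 by rewrite exprn_gt0.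
  move=> h.
  have h1 : c ^+ 4 * n ^+ 4 < (c ^+ 4 / r ^+ 2 * n ^+ 2) * (r ^+ 2 * n ^+ 2).
    apply: le_lt_trans h _.
    have K0 : 0 < c ^+ 4 / r ^+ 2 * n ^+ 2.
      by rewrite mulr_gt0// divr_gt0// exprn_gt0.
    have yK : y ^+ 2 - d ^+ 2 * n ^+ 2 <= c ^+ 4 / r ^+ 2 * n ^+ 2.
      rewrite lerBlDl -mulrDl (le_trans (ltW y2))// ler_pM2r//.
    apply: le_lt_trans (ler_wpM2r (sqr_ge0 y) yK) _.
    by rewrite ltr_pM2l// (lt_le_trans y2)// ler_pM2r.
  move: h1; rewrite (_ : _ * (r ^+ 2 * n ^+ 2) = c ^+ 4 * n ^+ 4) ?ltxx//.
  by field; rewrite gt_eqF.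
exfalso; have := ub_le_sup ubE Es; rewrite -/d leNgt => /negP; apply.
by rewrite -(ltr_pXn2r (n := 2))// ?nnegrE ?sqrtr_ge0// sqr_sqrtr.
Qed.

Variables alpha beta : R.
Hypothesis gap : forall t, alpha < t -> t < beta -> resolvent_set T t%:C.

Let sub_gap_lower_bound (m r : R) : 0 <= r -> alpha <= m - r -> m + r <= beta ->
  forall x, dom T x -> r * rnorm x <= rnorm (op_shift T m%:C x).
Proof.
move=> r0 h1 h2; apply: gap_lower_bound => // t t1 t2.
by apply: gap; lra.
Qed.

(** The largest interval centred at Re z inside the gap bounds the real shift; Im z then adds by
    Pythagoras. *)
Lemma gap_rnorm_shift_ge z x :
  alpha < complex.Re z -> complex.Re z < beta -> dom T x ->
  Num.sqrt (Num.min (complex.Re z - alpha) (beta - complex.Re z) ^+ 2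
    + complex.Im z ^+ 2) * rnorm x <= rnorm (op_shift T z x).
Proof.
move=> z1 z2 Tx; set d := Num.min _ _.
have d0 : 0 <= d by rewrite le_min !subr_ge0 !ltW.
have d1 : d <= complex.Re z - alpha by rewrite ge_min lexx.
have d2 : d <= beta - complex.Re z by rewrite ge_min lexx orbT.
have dz : d * rnorm x <= rnorm (op_shift T (complex.Re z)%:C x).
  by apply: sub_gap_lower_bound => //; lra.
rewrite -(@ler_pXn2r _ 2)// ?nnegrE ?mulr_ge0 ?sqrtr_ge0 ?rnorm_ge0//.
rewrite exprMn sqr_sqrtr ?addr_ge0 ?sqr_ge0// (sqr_rnorm_shift ip_norm T_sa)//.
rewrite mulrDl lerD2r -exprMn ler_pXn2r ?nnegrE ?mulr_ge0 ?rnorm_ge0//.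
Qed.

(* On the real line the quadratic q^2 (t - mu)^2 - a^2 - b^2 t^2 is nonpositive
   at mu and nonnegative at alpha and beta, so if it is not constant it is
   (q^2 - b^2) ((t - m)^2 - r^2) with [m - r, m + r] inside [alpha, beta]. *)
Lemma gap_relative_bound (a b q mu : R) x : 0 <= b -> b <= q ->
  alpha < mu -> mu < beta ->
  a ^+ 2 + b ^+ 2 * alpha ^+ 2 <= q ^+ 2 * (mu - alpha) ^+ 2 ->
  a ^+ 2 + b ^+ 2 * beta ^+ 2 <= q ^+ 2 * (beta - mu) ^+ 2 ->
  dom T x ->
  a ^+ 2 * rnorm x ^+ 2 + b ^+ 2 * rnorm (T x) ^+ 2
    <= q ^+ 2 * rnorm (op_shift T mu%:C x) ^+ 2.
Proof.
move=> b0 bq mu1 mu2 h1 h2 Tx.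
have [bqE|bqN] := eqVneq b q.
  (* For q = b the quadratic is affine in t; interpolating its values at [alpha] and [beta] gives a
     nonnegative value at [mu], which is -(a^2 + b^2 mu^2). Hence a = 0 and b mu = 0. *)
  have : (beta - alpha) * (a ^+ 2 + b ^+ 2 * mu ^+ 2) <= 0.
    have k1 : 0 <= (beta - mu) * (q ^+ 2 * (mu - alpha) ^+ 2
        - (a ^+ 2 + b ^+ 2 * alpha ^+ 2)).
      by rewrite mulr_ge0// subr_ge0// ltW.
    have k2 : 0 <= (mu - alpha) * (q ^+ 2 * (beta - mu) ^+ 2
        - (a ^+ 2 + b ^+ 2 * beta ^+ 2)).
      by rewrite mulr_ge0// subr_ge0// ltW.
    have := addr_ge0 k1 k2; rewrite -bqE -oppr_ge0 => k; apply: le_trans k _.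
    by rewrite le_eqVlt; apply/orP; left; apply/eqP; ring.
  rewrite pmulr_rle0 ?subr_gt0; last exact: lt_trans mu2.
  move=> ab0; have a20 := sqr_ge0 a; have bm0 := sqr_ge0 (b * mu).
  rewrite exprMn in bm0.
  have a2 : a ^+ 2 = 0 by lra.
  have bm : b ^+ 2 * mu ^+ 2 = 0 by lra.
  have bm' : b ^+ 2 * mu = 0.
    move/eqP: bm; rewrite mulf_eq0 !sqrf_eq0 => /orP[]/eqP->.
      by rewrite expr0n mul0r.
    by rewrite mulr0.
  rewrite (sqr_rnorm_real_shift ip_norm)// -bqE a2.
  rewrite [leRHS](_ : _ = b ^+ 2 * rnorm (T x) ^+ 2
    - 2 * (b ^+ 2 * mu) * rip ip (T x) x + (b ^+ 2 * mu ^+ 2) * rnorm x ^+ 2).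
    by rewrite bm bm' !(mul0r, mulr0) add0r addr0 subr0.
  by ring.
have {}bq : b < q by rewrite lt_def eq_sym bqN.
pose c := q ^+ 2 - b ^+ 2.
have c0 : 0 < c by rewrite subr_gt0 ltr_pXn2r ?nnegrE// (le_trans b0 (ltW bq)).
have cN0 : q ^+ 2 - b ^+ 2 != 0 by rewrite gt_eqF.
(* Completing the square: [m] is the midpoint of the two roots and [r2] the square of half their
   distance. *)
pose m := q ^+ 2 * mu / c.
pose r2 := (a ^+ 2 + b ^+ 2 * m ^+ 2 - q ^+ 2 * (m - mu) ^+ 2) / c.
have pE t : q ^+ 2 * (t - mu) ^+ 2 - (a ^+ 2 + b ^+ 2 * t ^+ 2) =
    c * ((t - m) ^+ 2 - r2).
  by rewrite /r2 /m /c; field.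
have mu_r2 : (mu - m) ^+ 2 <= r2.
  rewrite -subr_le0 -(pmulr_rle0 _ c0) -pE subrr expr0n mulr0 sub0r oppr_le0.
  by apply: addr_ge0; [exact: sqr_ge0|apply: mulr_ge0; exact: sqr_ge0].
have al_r2 : r2 <= (alpha - m) ^+ 2.
  by rewrite -subr_ge0 -(pmulr_rge0 _ c0) -pE subr_ge0 -(opprB mu) sqrrN.
have be_r2 : r2 <= (beta - m) ^+ 2.
  by rewrite -subr_ge0 -(pmulr_rge0 _ c0) -pE subr_ge0.
have r20 : 0 <= r2 := le_trans (sqr_ge0 _) mu_r2.
pose r := Num.sqrt r2.
have r0 : 0 <= r by exact: sqrtr_ge0.
have rr : r ^+ 2 = r2 by rewrite sqr_sqrtr.
have /andP[m1 m2] : - r <= mu - m <= r.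
  rewrite -ler_norml -(@ler_pXn2r _ 2)// ?nnegrE//.
  by rewrite real_normK ?num_real// rr.
(* Otherwise m - r < alpha < mu <= m + r, placing [alpha] strictly between the roots against
   [al_r2]; [bm] is symmetric. *)
have am : alpha <= m - r.
  rewrite leNgt; apply/negP => am; move: al_r2; apply/negP; rewrite -ltNge.
  rewrite -rr -real_normK ?num_real// ltr_pXn2r ?nnegrE// ltr_norml.
  by apply/andP; split; lra.
have bm : m + r <= beta.
  rewrite leNgt; apply/negP => bm; move: be_r2; apply/negP; rewrite -ltNge.
  rewrite -rr -real_normK ?num_real// ltr_pXn2r ?nnegrE// ltr_norml.
  by apply/andP; split; lra.
have := sub_gap_lower_bound r0 am bm Tx.
rewrite -(@ler_pXn2r _ 2)// ?nnegrE ?mulr_ge0 ?rnorm_ge0// exprMn rr.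
rewrite !(sqr_rnorm_real_shift ip_norm)//.
move: (rnorm x ^+ 2) (rnorm (T x) ^+ 2) (rip _ _ _) => n t p h.
rewrite -subr_ge0.
rewrite (_ : _ - _ = c * (t - 2 * m * p + m ^+ 2 * n - r2 * n)).
  by rewrite mulr_ge0 ?(ltW c0)// subr_ge0.
by rewrite /r2 /m /c; field.
Qed.

End SpectralGap.

(** * The resolvent estimates *)

Lemma sa_rnorm_act_le (R : realType) (H : completeNormedModType R[i])
    (ip : {dot H for (@Num.conj R[i])}) (T : linop H) (z : R[i]) (x : H) :
  induces_norm ip -> self_adjoint ip T -> dom T x ->
  complex.Im z ^+ 2 * rnorm (T x) ^+ 2 <=
    rnorm z ^+ 2 * rnorm (op_shift T z x) ^+ 2.
Proof.
move=> ip_norm T_sa Tx.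
rewrite (sqr_rnorm_shift ip_norm T_sa)// (sqr_rnorm_real_shift ip_norm)//.
have := sqr_ge0 (rnorm ((complex.Re z)%:C *: T x - (rnorm z ^+ 2)%:C *: x)).
rewrite (sqr_rnormB ip_norm (_ *: T x)) !sqr_rnormZ ripZl ripZr.
rewrite sqr_rnorm_complex -subr_ge0 => h; rewrite -subr_ge0.
by apply: le_trans h _; rewrite le_eqVlt; apply/orP; left; apply/eqP; ring.
Qed.

Theorem proposition2p8 (R : realType) (H : completeNormedModType R[i])
    (ip : {dot H for (@Num.conj R[i])}) (ip_norm : induces_norm ip)
    (T A : linop H) (T_sa : self_adjoint ip T)
    (A_bdd : rel_bounded T A) (A_bound : rel_bound T A < 1)
    (a b : R) (a_ge0 : 0 <= a) (b_ge0 : 0 <= b) (b_lt1 : b < 1)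
    (abP : rel_bound_pair T A a b) :
  (forall z : R[i],
     (a ^+ 2 + b ^+ 2 * `|complex.Re z| ^+ 2) / (1 - b ^+ 2)
       < `|complex.Im z| ^+ 2 ->
     resolvent_set (op_add T A) z /\
     (op_norm (resolvent (op_add T A) z) <=
       (1 / (`|complex.Im z|
             - Num.sqrt (a ^+ 2 + b ^+ 2 * rnorm z ^+ 2)))%:E)%E)
  /\
  (forall alpha beta : R, spectral_gap T alpha beta ->
     Num.sqrt (a ^+ 2 + b ^+ 2 * alpha ^+ 2)
       + Num.sqrt (a ^+ 2 + b ^+ 2 * beta ^+ 2) < beta - alpha ->
     forall z : R[i],
     alpha + Num.sqrt (a ^+ 2 + b ^+ 2 * alpha ^+ 2) < complex.Re z ->
     complex.Re z < beta - Num.sqrt (a ^+ 2 + b ^+ 2 * beta ^+ 2) ->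
     resolvent_set (op_add T A) z /\
     (op_norm (resolvent (op_add T A) z) <=
       (1 / Num.sqrt (Num.min (complex.Re z - alpha) (beta - complex.Re z) ^+ 2
                      + complex.Im z ^+ 2)
        * (1 / (1 - Num.max b
             (Num.max
               (Num.sqrt (a ^+ 2 + b ^+ 2 * alpha ^+ 2)
                  / (complex.Re z - alpha))
               (Num.sqrt (a ^+ 2 + b ^+ 2 * beta ^+ 2)
                  / (beta - complex.Re z))))))%:E)%E).
Proof.
have [TA _] := A_bdd.
have ab_ge0 (t : R) : 0 <= a ^+ 2 + b ^+ 2 * t ^+ 2.
  by apply: addr_ge0; [exact: sqr_ge0|apply: mulr_ge0; exact: sqr_ge0].
have A_leP z (q : R) x : 0 <= q -> dom T x ->
    a ^+ 2 * rnorm x ^+ 2 + b ^+ 2 * rnorm (T x) ^+ 2 <=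
      q ^+ 2 * rnorm (op_shift T z x) ^+ 2 ->
    rnorm (A x) <= q * rnorm (op_shift T z x).
  move=> q0 Tx h; rewrite -(@ler_pXn2r _ 2)// ?nnegrE ?mulr_ge0 ?rnorm_ge0//.
  by rewrite exprMn (le_trans _ h)//; exact: abP.
split=> [z hz|alpha beta [ab_lt gapP _ _] _ z z1 z2].
  have b21 : 0 < 1 - b ^+ 2 by rewrite subr_gt0 expr_lt1.
  have n0 : 0 < `|complex.Im z|.
    rewrite normr_gt0; apply/eqP => Im0; move: hz.
    by rewrite Im0 normr0 expr0n ltNge divr_ge0// ltW.
  move: hz; rewrite ltr_pdivrMr// real_normK ?num_real// => hz.
  set s := Num.sqrt _.
  have s0 : 0 <= s := sqrtr_ge0 _.
  have s2 : s ^+ 2 = a ^+ 2 + b ^+ 2 * rnorm z ^+ 2 by rewrite sqr_sqrtr.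
  (* Squared and with |z|^2 split into real and imaginary parts, this is exactly the assumption on
     [z]. *)
  have sn : s < `|complex.Im z|.
    rewrite -(@ltr_pXn2r _ 2)// ?nnegrE// s2 sqr_rnorm_complex.
    move: hz; rewrite [X in _ < X * _ -> _]real_normK ?num_real//.
    rewrite real_normK ?num_real//; lra.
  (* This exhibits the perturbation constants q = s / |Im z| and c = |Im z|. *)
  have -> : `|complex.Im z| - s = (1 - s / `|complex.Im z|) * `|complex.Im z|.
    by field; rewrite gt_eqF.
  apply: (perturbed_resolvent ip_norm T_sa TA) => //.
  - by rewrite divr_ge0// ltW.
  - by rewrite ltr_pdivrMr// mul1r.
  - by move=> x; exact: rnorm_shift_ge_Im.
  - by apply: sa_shift_surjective => //; rewrite -normr_gt0.
  - move=> x Tx; apply: A_leP => //; first by rewrite divr_ge0// ltW.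
    rewrite exprMn exprVn s2 [leRHS]mulrAC ler_pdivlMr ?exprn_gt0//.
    (* Termwise: Im(z)^2 |x|^2 and Im(z)^2 |T x|^2 are at most |(T - z) x|^2 and |z|^2 |(T - z)
       x|^2. *)
    rewrite real_normK ?num_real// mulrDl [leRHS]mulrDl lerD//.
      rewrite -mulrA ler_wpM2l ?sqr_ge0// (sqr_rnorm_shift ip_norm T_sa)//.
      rewrite mulrC.
      by rewrite lerDr sqr_ge0.
    rewrite -(mulrA _ (rnorm (T x) ^+ 2)) -(mulrA _ (rnorm z ^+ 2)).
    rewrite ler_wpM2l ?sqr_ge0// [leLHS]mulrC.
    exact: sa_rnorm_act_le ip_norm T_sa Tx.
have gap t : alpha < t -> t < beta -> resolvent_set T t%:C.
  move=> t1 t2; apply: contrapT => nt.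
  suff : (set0 : set R[i]) t%:C by [].
  by rewrite -gapP; split => //; exists t => //=; rewrite in_itv /= t1.
set sa := Num.sqrt (a ^+ 2 + b ^+ 2 * alpha ^+ 2) in z1 *.
set sb := Num.sqrt (a ^+ 2 + b ^+ 2 * beta ^+ 2) in z2 *.
have sa0 : 0 <= sa := sqrtr_ge0 _.
have sb0 : 0 <= sb := sqrtr_ge0 _.
have za : 0 < complex.Re z - alpha by lra.
have zb : 0 < beta - complex.Re z by lra.
set q := Num.max b _.
have bq : b <= q by rewrite le_max lexx.
have q0 : 0 <= q := le_trans b_ge0 bq.
have qa : sa <= q * (complex.Re z - alpha).
  by rewrite -ler_pdivrMr// !le_max lexx !orbT.
have qb : sb <= q * (beta - complex.Re z).
  by rewrite -ler_pdivrMr// !le_max lexx !orbT.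
(* The strict bounds on Re z say that both quotients are below 1. *)
have q1 : q < 1.
  by rewrite !gt_max b_lt1 !ltr_pdivrMr// !mul1r; apply/andP; split => //; lra.
set c := Num.sqrt (_ ^+ 2 + _).
have c0 : 0 < c.
  by rewrite sqrtr_gt0 ltr_pwDl ?sqr_ge0// exprn_gt0// lt_min za.
have -> : 1 / c * (1 / (1 - q)) = 1 / ((1 - q) * c).
  by field; rewrite !gt_eqF// subr_gt0.
have za' : alpha < complex.Re z by rewrite -subr_gt0.
have zb' : complex.Re z < beta by rewrite -subr_gt0.
apply: (perturbed_resolvent ip_norm T_sa TA) => //.
- by move=> x Tx; exact: gap_rnorm_shift_ge.
(* A real [z] lies in the gap, hence in the resolvent set of [T]; otherwise self-adjointness gives
   surjectivity. *)
- have [z0|z0] := eqVneq (complex.Im z) 0; last exact: sa_shift_surjective.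
  rewrite [z]complexE z0 mulr0 addr0.
  by apply: resolvent_set_surjective; exact: gap.
- move=> x Tx; apply: A_leP => //.
  (* The relative bound is proved at the real point Re z; adding Im z only enlarges the right-hand
     side. *)
  apply: (@le_trans _ _ (q ^+ 2 * rnorm (op_shift T (complex.Re z)%:C x) ^+ 2)).
    apply: (gap_relative_bound ip_norm T_sa gap) => //.
      rewrite -[leRHS]exprMn -[leLHS]sqr_sqrtr// ler_pXn2r ?nnegrE ?sqrtr_ge0//.
      exact: mulr_ge0 (ltW _).
    rewrite -[leRHS]exprMn -[leLHS]sqr_sqrtr// ler_pXn2r ?nnegrE ?sqrtr_ge0//.
    exact: mulr_ge0 (ltW _).
  rewrite ler_wpM2l ?sqr_ge0// (sqr_rnorm_shift ip_norm T_sa z)// lerDl.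
  by rewrite mulr_ge0 ?sqr_ge0.
Qed.
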